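(* Let $X\in\mathcal{C}([0,1]^d)$ be a q.m. continuous random field, and let $X_N=X_N(X,T_N)$ be its multivariate piecewise linear interpolator, where $T_N$ is a $cRS(h,\pi,\mathbf{l})$ sequence of designs with $h=(h_1,\ldots,h_k)$ and $\pi(N)=(n_1,\ldots,n_k)$. (i) If $X\in\mathcal{C}_{\mathbf{l}}^{\boldsymbol\alpha}([0,1]^d,C)$, then there are positive constants $c_1,\ldots,c_k$ (independent of $N$) such that $$\|X-X_N\|_\infty\le\sqrt{C}\sum_{j=1}^k\frac{c_j}{n_j^{\alpha_j/2}}.$$ (ii) If $X\in\mathcal{C}_{\mathbf{l}}^{1,\boldsymbol\alpha}([0,1]^d,C)$, then there are positive constants $d_1,\ldots,d_k$ (independent of $N$) such that $$\|X-X_N\|_\infty\le\sqrt{C}\sum_{j=1}^k\frac{d_j}{n_j^{1+\alpha_j/2}}.$$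
   Context: Random fields: $X=X(\mathbf{t})$, $\mathbf{t}\in[0,1]^d$, is a real-valued random field with $\mathrm{E}X(\mathbf{t})^2<\infty$ for all $\mathbf{t}$. For a random variable $\xi$ put $\|\xi\|:=(\mathrm{E}\xi^2)^{1/2}$; for vectors, $\|\cdot\|$ is the Euclidean norm. $\mathcal{C}([0,1]^d)$ and $\mathcal{C}^1([0,1]^d)$ are the spaces of quadratic mean (q.m.) continuous and q.m. continuously differentiable random fields, i.e. those for which $\mathbf{t}\mapsto X(\mathbf{t})\in L^2(\Omega)$ is continuous, respectively continuously differentiable. For $Y\in\mathcal{C}([0,1]^d)$, $\|Y\|_\infty:=\max_{\mathbf{t}\in[0,1]^d}\|Y(\mathbf{t})\|$. Decomposition: $k\le d$, $\mathbf{l}=(l_1,\ldots,l_k)$ is a vector of positive integers with $\sum_{j=1}^k l_j=d$, $L_0=0$, $L_i=\sum_{j=1}^i l_j$. For $\mathbf{s}\in\mathbb{R}^d$, $\mathbf{s}^j:=(s_{L_{j-1}+1},\ldots,s_{L_j})$, $j=1,\ldots,k$. $\boldsymbol\alpha=(\alpha_1,\ldots,\alpha_k)$ with $0<\alpha_j<2$, and $C>0$ is a constant. Hölder classes: $X\in\mathcal{C}_{\mathbf{l}}^{\boldsymbol\alpha}([0,1]^d,C)$ means $X\in\mathcal{C}([0,1]^d)$ and $$\|X(\mathbf{t}+\mathbf{s})-X(\mathbf{t})\|^2\le C\sum_{j=1}^k\|\mathbf{s}^j\|^{\alpha_j}\quad\text{for all }\mathbf{t},\mathbf{t}+\mathbf{s}\in[0,1]^d.$$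 $X\in\mathcal{C}_{\mathbf{l}}^{1,\boldsymbol\alpha}([0,1]^d,C)$ means $X\in\mathcal{C}^1([0,1]^d)$ and, with $\alpha_i^*:=\alpha_j$ for $i=L_{j-1}+1,\ldots,L_j$, and $X_i'$ the q.m. partial derivative with respect to the $i$-th coordinate, for all $\mathbf{t},\mathbf{t}+\mathbf{s}\in[0,1]^d$, $$\|X_i'(t_1,\ldots,t_i+s_i,\ldots,t_d)-X_i'(t_1,\ldots,t_i,\ldots,t_d)\|^2\le C|s_i|^{\alpha_i^*},\quad i=1,\ldots,d.$$ Designs: $h_1,\ldots,h_k$ are positive continuous probability densities on $[0,1]$, not depending on $N$. $N$ ranges over an infinite set of positive integers, and for each such $N$, $\pi(N)=(n_1,\ldots,n_k)=(n_1(N),\ldots,n_k(N))$ is a vector of positive integers with $\prod_{j=1}^k(n_j+1)^{l_j}=N$ and $n_j(N)\to\infty$ as $N\to\infty$ for each $j$. For $i=L_{j-1}+1,\ldots,L_j$ put $h_i^*:=h_j$, $n_i^*:=n_j$. The design $T_N$ is $cRS(h,\pi,\mathbf{l})$ (cross regular sequence) if $T_N=\{\mathbf{t}_{\mathbf{i}}=(t_{1,i_1},\ldots,t_{d,i_d}):0\le i_m\le n_m^*,\ m=1,\ldots,d\}$, where $\int_0^{t_{m,i}}h_m^*(v)\,dv=i/n_m^*$, $i=0,\ldots,n_m^*$. Interpolator: let $*$ denote coordinatewise multiplication. For $\mathbf{i}$ with $0\le i_m\le n_m^*-1$ let $\mathbf{r}_{\mathbf{i}}=\mathbf{t}_{\mathbf{i}+(1,\ldots,1)}-\mathbf{t}_{\mathbf{i}}$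 and $\mathcal{D}_{\mathbf{i}}=\{\mathbf{t}_{\mathbf{i}}+\mathbf{r}_{\mathbf{i}}*\mathbf{s}:\mathbf{s}\in[0,1]^d\}$. The multivariate piecewise linear interpolator (MPLI) is $$X_N(\mathbf{t}):=\mathrm{E}_{\boldsymbol\eta}X(\mathbf{t}_{\mathbf{i}}+\mathbf{r}_{\mathbf{i}}*\boldsymbol\eta),\quad \mathbf{t}=\mathbf{t}_{\mathbf{i}}+\mathbf{r}_{\mathbf{i}}*\mathbf{s}\in\mathcal{D}_{\mathbf{i}},$$ where $\boldsymbol\eta=(\eta_1,\ldots,\eta_d)$ has independent Bernoulli components with means $s_1,\ldots,s_d$, auxiliary to (independent of) $X$, and $\mathrm{E}_{\boldsymbol\eta}$ is expectation over $\boldsymbol\eta$ only; i.e. $X_N(\mathbf{t})=\sum_{\mathbf{e}\in\{0,1\}^d}X(\mathbf{t}_{\mathbf{i}}+\mathbf{r}_{\mathbf{i}}*\mathbf{e})\prod_{m=1}^d s_m^{e_m}(1-s_m)^{1-e_m}$. *)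

(* Defs.v *)
From HB Require Import structures.
From mathcomp Require Import all_boot all_order all_algebra.
From mathcomp Require Import all_classical all_reals all_analysis.
Set Implicit Arguments.
Unset Strict Implicit.
Unset Printing Implicit Defensive.
Import Order.TTheory GRing.Theory Num.Theory.
Import numFieldNormedType.Exports.
Local Open Scope classical_set_scope.
Local Open Scope ring_scope.

(* A random field on [0,1]^d is a map X : 'rV[R]_d -> Omega -> R of which only
   the values at the points of [cube] matter.  For block sizes l : 'I_k -> nat
   the dimension is written \sum_(j < k) l j, so that the block s^j of s is
   [submxrow s j] and the block containing the coordinate i is
   [tagnat.sig1 i : 'I_k]. *)

Section Points.
Context {R : realType}.

Definition cube {d : nat} : set 'rV[R]_d :=
  [set t | forall i, 0 <= t 0 i <= 1].

(* The library norm on 'rV[R]_d is the sup norm; it induces the same topology. *)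
Definition enorm {d : nat} (s : 'rV[R]_d) : R :=
  Num.sqrt (\sum_i s 0 i ^+ 2).

Definition hadamard {d : nat} (r s : 'rV[R]_d) : 'rV[R]_d := map2_mx *%R r s.

End Points.

Definition starred {T : Type} {k : nat} {l : 'I_k -> nat} (a : 'I_k -> T)
  (i : 'I_(\sum_(j < k) l j)) : T := a (tagnat.sig1 i).

Section RandomFields.
Context {R : realType} {disp : measure_display} {Omega : measurableType disp}.
Variable P : probability Omega R.

Definition qmnorm (xi : Omega -> R) : \bar R := Lnorm P 2%:E (EFin \o xi).

(* The supremum is taken in the extended reals; for a q.m. continuous field it
   is a finite maximum. *)
Definition qmsupnorm {d : nat} (Y : 'rV[R]_d -> Omega -> R) : \bar R :=
  ereal_sup [set qmnorm (Y t) | t in cube].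

Definition qm_continuous {d : nat} (X : 'rV[R]_d -> Omega -> R) : Prop :=
  (forall t, cube t -> X t \in Lfun P 2%:E) /\
  (forall t, cube t ->
     qmnorm (X s \- X t) @[s --> within cube (nbhs t)] --> 0%E).

(* One-sided at the faces of the cube, as only the increments u with
   t + u e_i in the cube are considered. *)
Definition is_qm_partial {d : nat} (X : 'rV[R]_d -> Omega -> R) (i : 'I_d)
    (Y : 'rV[R]_d -> Omega -> R) : Prop :=
  forall t, cube t ->
    qmnorm (fun w => (X (t + u *: delta_mx 0 i) w - X t w) / u - Y t w)
      @[u --> within [set u : R | cube (t + u *: delta_mx 0 i)] (0 : R)^']
      --> 0%E.

Definition is_qm_C1_gradient {d : nat} (X : 'rV[R]_d -> Omega -> R)
    (X' : 'I_d -> 'rV[R]_d -> Omega -> R) : Prop :=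
  qm_continuous X /\
  forall i, is_qm_partial X i (X' i) /\ qm_continuous (X' i).

Definition holder_field {k : nat} {l : 'I_k -> nat} (alpha : 'I_k -> R) (C : R)
    (X : 'rV[R]_(\sum_(j < k) l j) -> Omega -> R) : Prop :=
  qm_continuous X /\
  forall t s, cube t -> cube (t + s) ->
    (qmnorm (X (t + s) \- X t)%R ^+ 2
       <= (C * \sum_(j < k) enorm (submxrow s j) `^ alpha j)%:E)%E.

(* The q.m. partial derivatives are unique up to almost sure equality at each
   point, so the choice of the gradient X' is immaterial. *)
Definition holder1_field {k : nat} {l : 'I_k -> nat} (alpha : 'I_k -> R) (C : R)
    (X : 'rV[R]_(\sum_(j < k) l j) -> Omega -> R) : Prop :=
  exists X' : 'I_(\sum_(j < k) l j) ->
              'rV[R]_(\sum_(j < k) l j) -> Omega -> R,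
    is_qm_C1_gradient X X' /\
    forall t s, cube t -> cube (t + s) -> forall i,
      (qmnorm (X' i (t + s 0 i *: delta_mx 0 i) \- X' i t)%R ^+ 2
         <= (C * `|s 0 i| `^ starred alpha i)%:E)%E.

End RandomFields.

Section Designs.
Context {R : realType}.

Definition positive_continuous_density (f : R -> R) : Prop :=
  [/\ {within `[0, 1], continuous f},
      (forall x, 0 <= x <= 1 -> 0 < f x) &
      (\int[lebesgue_measure]_(x in `[0%R, 1%R]) (f x)%:E = 1)%E].

(* tau m i is the i-th knot t_{m,i} of coordinate m. *)
Definition is_cRS {k : nat} {l : 'I_k -> nat} (h : 'I_k -> R -> R)
    (n : 'I_k -> nat) (tau : 'I_(\sum_(j < k) l j) -> nat -> R) : Prop :=
  forall m (i : nat), (i <= starred n m)%N ->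
    0 <= tau m i <= 1 /\
    (\int[lebesgue_measure]_(v in `[0%R, tau m i]) (starred h m v)%:E
       = (i%:R / (starred n m)%:R)%:E)%E.

Definition grid_point {d : nat} (tau : 'I_d -> nat -> R)
  (i : {ffun 'I_d -> nat}) : 'rV[R]_d := \row_m tau m (i m).

Definition cell_size {d : nat} (tau : 'I_d -> nat -> R)
    (i : {ffun 'I_d -> nat}) : 'rV[R]_d :=
  grid_point tau [ffun m => (i m).+1] - grid_point tau i.

(* The expectation over eta, written as a sum over the values e of eta. *)
Definition cell_interpolant {d : nat} {Omega : Type}
    (X : 'rV[R]_d -> Omega -> R) (tau : 'I_d -> nat -> R)
    (i : {ffun 'I_d -> nat}) (s : 'rV[R]_d) (w : Omega) : R :=
  \sum_(e : {ffun 'I_d -> bool})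
    X (grid_point tau i + hadamard (cell_size tau i) (\row_m (e m)%:R)) w *
    \prod_m (s 0 m ^+ e m * (1 - s 0 m) ^+ (1 - e m)).

Definition cell_coordinates {d : nat} (ns : 'I_d -> nat)
    (tau : 'I_d -> nat -> R) (t : 'rV[R]_d) :
    set ({ffun 'I_d -> nat} * 'rV[R]_d) :=
  [set p : {ffun 'I_d -> nat} * 'rV[R]_d |
    [/\ forall m, (p.1 m < ns m)%N, cube p.2 &
        t = grid_point tau p.1 + hadamard (cell_size tau p.1) p.2]].

(* Distinct cells meet only along common faces, where their interpolants agree,
   so the cell selected by [xget] is immaterial; the default is used only
   outside the cube. *)
Definition mpli {d : nat} {Omega : Type} (X : 'rV[R]_d -> Omega -> R)
    (ns : 'I_d -> nat) (tau : 'I_d -> nat -> R) (t : 'rV[R]_d) : Omega -> R :=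
  let p := xget ([ffun=> 0%N], 0) (cell_coordinates ns tau t) in
  cell_interpolant X tau p.1 p.2.

End Designs.

(* Main.v *)
Require Import Defs.
From HB Require Import structures.
From mathcomp Require Import all_boot all_order all_algebra.
From mathcomp Require Import all_classical all_reals all_analysis.
From mathcomp Require Import measurable_realfun ring lra.
Import Order.TTheory GRing.Theory Num.Theory.
Import numFieldNormedType.Exports.
Set Implicit Arguments.
Unset Strict Implicit.
Unset Printing Implicit Defensive.
Local Open Scope classical_set_scope.
Local Open Scope ring_scope.

(** The error of multilinear interpolation reduces to the error of linear
interpolation in a single coordinate.  Inside a cell the multilinear interpolant
of [X] arises from [X] by interpolating linearly in one coordinate after the
other, and each such step is a convex combination of values of the field, hence
does not increase q.m. norms.  Changing one coordinate at a time therefore gives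
[cell_interpolant_error]: the error of the cell is at most the sum over the
coordinates of the one-coordinate errors, uniformly in the remaining
coordinates.

On a segment of length [r] in a direction [m] with exponent [a], the
one-coordinate error is at most [sqrt C * r^(a/2)] for a Hölder field, since
moving along one coordinate makes a single block of the increment nonzero
([holder_coord_interp_le]).  If the field is q.m. differentiable with Hölder
partial derivatives, linear interpolation is exact on affine functions, so the
affine part [u * X'_m] frozen at the left endpoint may be subtracted; the
remainder has a derivative of norm at most [sqrt C * r^(a/2)], and the mean
value inequality in L2 ([qm_mean_value]) supplies the extra factor [r]
([holder1_coord_interp_le]).

A positive continuous density on [[0, 1]] is bounded below by some [mu > 0], so
consecutive knots, which cut off mass [1/n], are at distance at most [1/(mu n)]
([knots_step]), and the cells cover the cube ([knots_cover]).  Inserting these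
lengths and summing over the [l_j] coordinates of each block gives both rates,
with constants [l_j * mu_j^(-beta_j)] where [beta_j] is [alpha_j/2] or
[1 + alpha_j/2] ([mpli_rate]). *)

(** * Bounds on the quadratic mean norm *)

Section Bounds.
Context {R : realType} {disp : measure_display} {Omega : measurableType disp}.
Variable P : probability Omega R.
Implicit Types (f g : Omega -> R) (A B : R).

(** Square integrability is part of the bound because Minkowski's inequality
requires measurability; bounds then combine with no side conditions. *)
Definition qm_le f B := f \in Lfun P 2%:E /\ (qmnorm P f <= B%:E)%E.

Lemma qm_le_ext f g B : f =1 g -> qm_le f B -> qm_le g B.
Proof. by move=> /funext ->. Qed.

Lemma qm_le_weaken f A B : A <= B -> qm_le f A -> qm_le f B.
Proof. by move=> AB [lf fA]; split=> //; rewrite (le_trans fA)// lee_fin. Qed.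

Lemma qm_leD f g A B : qm_le f A -> qm_le g B ->
  qm_le (fun w => f w + g w) (A + B).
Proof.
move=> [lf fA] [lg gB].
have two : (1 <= 2%:E :> \bar R)%E by rewrite lee_fin ler1n.
split; first exact: (Lfun_addr_closed _ two).2.
rewrite EFinD (le_trans _ (leeD fA gB))//.
have m u : u \in Lfun P 2%:E -> measurable_fun setT u.
  by move=> /sub_Lfun_mfun/set_mem.
by apply: minkowski_EFin; rewrite ?ler1n//; exact: m.
Qed.

Lemma qm_leZ f a B : qm_le f B -> qm_le (fun w => a * f w) (`|a| * B).
Proof.
move=> [lf fB].
have two : (1 <= 2%:E :> \bar R)%E by rewrite lee_fin ler1n.
have e : (fun w => a * f w) = a *: (f : Omega -> R^o) by [].
split.
  have := (Lfun_submod_closed P two).2 a f 0 lf (Lfun_submod_closed P two).1.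
  by rewrite addr0.
have := LnormZ (Lfun_Sub two lf) a; rewrite /qmnorm EFinM => ->.
by rewrite lee_wpmul2l.
Qed.

Lemma qm_le0 : qm_le (fun=> 0) 0.
Proof.
split; first exact: Lfun_cst.
by rewrite /qmnorm (_ : EFin \o _ = cst 0%E)// Lnorm0// eqe pnatr_eq0.
Qed.

Lemma qm_le_sum (I : Type) (r : seq I) (F : I -> Omega -> R) (B : I -> R) :
  (forall i, qm_le (F i) (B i)) ->
  qm_le (fun w => \sum_(i <- r) F i w) (\sum_(i <- r) B i).
Proof.
move=> FB; elim: r => [|i r IH].
  by rewrite big_nil; apply: qm_le_ext qm_le0 => w; rewrite big_nil.
rewrite big_cons; apply: qm_le_ext (qm_leD (FB i) IH) => w /=.
by rewrite big_cons.
Qed.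

Lemma qm_le_convex (I : finType) (c : I -> R) (F : I -> Omega -> R) B :
  (forall i, 0 <= c i) -> \sum_i c i = 1 -> (forall i, qm_le (F i) B) ->
  qm_le (fun w => \sum_i c i * F i w) B.
Proof.
move=> c0 c1 FB; rewrite -[B]mul1r -c1 mulr_suml.
apply: qm_le_sum => i; rewrite -{2}(ger0_norm (c0 i)).
exact: qm_leZ.
Qed.

Lemma qm_leB f g A B : qm_le f A -> qm_le g B ->
  qm_le (fun w => f w - g w) (A + B).
Proof.
move=> fA /(qm_leZ (-1)) gB; rewrite normrN1 mul1r in gB.
by apply: qm_le_ext (qm_leD fA gB) => w; rewrite mulN1r.
Qed.

Lemma qm_le_Lfun f : f \in Lfun P 2%:E -> exists B, qm_le f B.
Proof.
move=> lf; exists (fine (qmnorm P f)); split=> //; rewrite fineK//.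
rewrite ge0_fin_numE ?Lnorm_ge0//.
exact: set_mem (sub_Lfun_finLfun lf).
Qed.

Lemma qm_le_all_eps f B : (forall e, 0 < e -> qm_le f (B + e)) -> qm_le f B.
Proof.
move=> fB; split; first by have [] := fB 1 ltr01.
by apply/lee_addgt0Pr => e e0; have [] := fB e e0.
Qed.

Lemma qm_le_sqr f (A : R) : 0 <= A -> f \in Lfun P 2%:E ->
  (qmnorm P f ^+ 2 <= (A ^+ 2)%:E)%E -> qm_le f A.
Proof.
move=> A0 lf fA; split=> //; have [B [_ fB]] := qm_le_Lfun lf.
have q0 : (0 <= qmnorm P f)%E by exact: Lnorm_ge0.
move: q0 fA fB; case: (qmnorm P f) => [r| |]//; rewrite -EFin_expe !lee_fin.
by move=> r0; rewrite ler_sqr.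
Qed.

(** Hölder conditions bound the squared norm at the actual displacement [v];
the error estimates need the norm, and the length [r] of a whole segment. *)
Lemma qm_le_holder f (C a v r : R) : 0 <= C -> 0 <= a -> `|v| <= r ->
  f \in Lfun P 2%:E -> (qmnorm P f ^+ 2 <= (C * `|v| `^ a)%:E)%E ->
  qm_le f (Num.sqrt C * r `^ (a / 2)).
Proof.
move=> C0 a0 vr lf fC.
apply: (@qm_le_weaken _ (Num.sqrt C * `|v| `^ (a / 2))).
  rewrite ler_wpM2l ?sqrtr_ge0//; apply: ge0_ler_powR => //.
    by rewrite divr_ge0.
  exact: le_trans vr.
apply: qm_le_sqr; rewrite ?mulr_ge0 ?sqrtr_ge0 ?powR_ge0//.
rewrite exprMn sqr_sqrtr// -powR_mulrn ?powR_ge0//.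
by rewrite -powRrM divfK// pnatr_eq0.
Qed.

End Bounds.

(** * The mean value inequality in quadratic mean *)

(** A transitive relation on a segment that holds between each point and its
neighbours holds between the endpoints.  The supremum of the points related to
[a] is itself related to [a], being a neighbour of one of them, and if it were
below [b] then a neighbour to its right would be a larger such point. *)
Lemma continuous_induction {R : realType} (Q : R -> R -> Prop) (a b : R) :
  a <= b -> (forall x, Q x x) ->
  (forall x y z, a <= x <= y -> y <= z <= b -> Q x y -> Q y z -> Q x z) ->
  (forall c, a <= c <= b -> exists2 e, 0 < e &
     forall x, a <= x <= b -> `|x - c| < e ->
       (x <= c -> Q x c) /\ (c <= x -> Q c x)) ->
  Q a b.
Proof.
move=> ab Qxx Qtr Qloc.
pose S := [set x | a <= x <= b /\ Q a x].
have Sa : S a by split=> //; rewrite lexx.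
have hS : has_sup S by split; [exists a | exists b => x [/andP[]]].
have ubS x : S x -> x <= sup S by move=> Sx; exact: ub_le_sup hS.2 _ Sx.
have cab : a <= sup S <= b.
  by rewrite ubS//=; apply: ge_sup => [|x [/andP[]]//]; exists a.
have [e e0 He] := Qloc _ cab.
have [x Sx xe] := sup_adherent e0 hS.
have xc := ubS _ Sx.
have Qac : Q a (sup S).
  have [xab Qax] := Sx; have /andP[ax xb] := xab.
  apply: (Qtr _ x) => //; first by rewrite lexx.
    by rewrite xc; case/andP: cab.
  apply: (He _ xab _).1 => //.
  by rewrite ler0_norm ?subr_le0// opprB ltrBlDr -ltrBlDl.
have [cb|cb] := ltP (sup S) b; last first.
  by have -> : b = sup S by apply/eqP; rewrite eq_le cb; case/andP: cab.
pose y := Num.min b (sup S + e / 2).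
have cy : sup S < y by rewrite lt_min cb ltrDl divr_gt0.
have yb : y <= b by rewrite ge_min lexx.
have ye : y <= sup S + e / 2 by rewrite ge_min lexx orbT.
have /andP[ac _] := cab.
have yab : a <= y <= b by rewrite yb (le_trans ac (ltW cy)).
suff : y <= sup S by rewrite leNgt cy.
apply: ubS; split=> //; apply: (Qtr _ (sup S)); rewrite ?lexx ?ac ?(ltW cy)//.
apply: (He _ yab _).2; last exact: ltW.
rewrite gtr0_norm ?subr_gt0//; lra.
Qed.

Section Increments.
Context {R : realType} {disp : measure_display} {Omega : measurableType disp}.
Variable P : probability Omega R.

(** Near each point the difference quotients of [g] have norm at most [M + e'],
and a bound on increments by a multiple of the length is transitive, so
continuous induction extends it to the whole segment.  The hypothesis is
one-sided at [a] and [b]. *)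
Lemma qm_mean_value (g g' : R -> Omega -> R) (a b M : R) : a <= b ->
  (forall c, a <= c <= b -> qm_le P (g' c) M) ->
  (forall c, a <= c <= b -> forall e, 0 < e -> exists2 r, 0 < r &
    forall u, a <= c + u <= b -> u != 0 -> `|u| < r ->
      qm_le P (fun w => (g (c + u) w - g c w) / u - g' c w) e) ->
  qm_le P (fun w => g b w - g a w) (M * (b - a)).
Proof.
move=> ab g'M dg; apply: qm_le_all_eps => e e0.
(* The total excess [e' * (b - a)] stays below [e], also when [a = b]. *)
pose e' := e / (b - a + 1).
have e'0 : 0 < e' by rewrite divr_gt0// ltr_wpDl ?subr_ge0.
suff H : qm_le P (fun w => g b w - g a w) ((M + e') * (b - a)).
  apply: qm_le_weaken H; rewrite mulrDl lerD2l.
  rewrite mulrAC ler_pdivrMr ?ltr_wpDl ?subr_ge0//.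
  by rewrite ler_pM2l// lerDl.
pose Q x y := qm_le P (fun w => g y w - g x w) ((M + e') * (y - x)).
have Qxx x : Q x x.
  by rewrite /Q subrr mulr0; apply: qm_le_ext (qm_le0 P) => w; rewrite subrr.
apply: (@continuous_induction _ Q) => //.
  move=> x y z _ _ Qxy Qyz; rewrite /Q.
  have -> : (M + e') * (z - x) = (M + e') * (y - x) + (M + e') * (z - y).
    by ring.
  by apply: qm_le_ext (qm_leD Qxy Qyz) => w; ring.
move=> c cab; have [r r0 Hr] := dg c cab _ e'0.
exists r => // x xab xr.
have [->//|xc] := eqVneq x c.
have u0 : x - c != 0 by rewrite subr_eq0.
have cxc : c + (x - c) = x by ring.
have := Hr (x - c); rewrite cxc => /(_ xab u0 xr) H.
have {}H := qm_leD H (g'M c cab).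
split=> xlec; rewrite /Q [M + e']addrC mulrC -[X in X * _]ger0_norm ?subr_ge0//.
- by apply: qm_le_ext (qm_leZ (c - x) H) => w; field.
- by apply: qm_le_ext (qm_leZ (x - c) H) => w; field.
Qed.
End Increments.

(** * Interpolation in one coordinate *)

Section Coord.
Context {R : realType}.

Definition set_coord d (t : 'rV[R]_d) (i : 'I_d) (u : R) : 'rV[R]_d :=
  \row_m if m == i then u else t 0 m.

Lemma set_coordE d (t : 'rV[R]_d) i u m :
  set_coord t i u 0 m = if m == i then u else t 0 m.
Proof. by rewrite mxE. Qed.

Lemma cube_set_coord d (t : 'rV[R]_d) i u :
  cube t -> 0 <= u <= 1 -> cube (set_coord t i u).
Proof. by move=> ct u01 m; rewrite set_coordE; case: eqP. Qed.

Lemma set_coordD d (t : 'rV[R]_d) i u v :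
  set_coord t i u + v *: delta_mx 0 i = set_coord t i (u + v).
Proof.
apply/rowP => m; rewrite mxE !set_coordE !mxE eqxx /=.
by case: eqP => _; rewrite ?mulr1 // mulr0 addr0.
Qed.

(** An increment along one coordinate lies in a single block, where its
Euclidean norm is [`|v|]; the other blocks contribute [0 `^ alpha j], which
vanishes as [alpha j] is nonzero. *)
Lemma starred_enorm (k : nat) (l : 'I_k -> nat) (alpha : 'I_k -> R)
  (m : 'I_(\sum_(j < k) l j)) (v : R) : (forall j, 0 < alpha j) ->
  \sum_(j < k) enorm (submxrow (v *: delta_mx 0 m) j) `^ alpha j =
  `|v| `^ starred alpha m.
Proof.
move=> a0; rewrite (bigD1 (tagnat.sig1 m)) //= [X in _ + X]big1 ?addr0.
  rewrite /starred; congr (_ `^ _); rewrite /enorm.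
  rewrite (bigD1 (tagnat.sig2 m)) //= [X in _ + X]big1 ?addr0.
    rewrite !mxE eqxx; set e := (X in X == m).
    have -> : e = m by exact: tagnat.sig2K.
    by rewrite eqxx mulr1 sqrtr_sqr.
  move=> i im; rewrite !mxE eqxx /=.
  case: eqP => [e|_]; last by rewrite mulr0 expr0n.
  case/eqP: im; move: e; rewrite -[RHS]tagnat.sig2K.
  by move=> /tagnat.rank_inj/eqP; rewrite eq_Tagged => /eqP.
move=> j jm; rewrite /enorm big1 ?sqrtr0 ?powR0 ?gt_eqF// => i _.
rewrite !mxE eqxx /=; case: eqP => [e|_]; last by rewrite mulr0 expr0n.
by move: jm; rewrite -e tagnat.Rank1K eqxx.
Qed.

End Coord.

Section OneCoordinate.
Context {R : realType} {disp : measure_display} {Omega : measurableType disp}.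
Variable P : probability Omega R.

(** [E m r] bounds the error of linear interpolation of [X] along coordinate [m]
over every segment of length [r] in the cube, uniformly in the other
coordinates. *)
Definition coord_interp_le d (X : 'rV[R]_d -> Omega -> R)
    (E : 'I_d -> R -> R) := forall m t a b s, cube t ->
  0 <= a -> a <= b -> b <= 1 -> 0 <= s <= 1 ->
  qm_le P (fun w => X (set_coord t m (a + s * (b - a))) w -
    ((1 - s) * X (set_coord t m a) w + s * X (set_coord t m b) w))
  (E m (b - a)).

Lemma qm_le_interp (f g h : Omega -> R) s B : 0 <= s <= 1 ->
  qm_le P (fun w => f w - g w) B -> qm_le P (fun w => f w - h w) B ->
  qm_le P (fun w => f w - ((1 - s) * g w + s * h w)) B.
Proof.
move=> /andP[s0 s1] fg fh.
have B1 : `|1 - s| * B + `|s| * B = B.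
  by rewrite !ger0_norm ?subr_ge0//; ring.
rewrite -B1; apply: qm_le_ext (qm_leD (qm_leZ (1 - s) fg) (qm_leZ s fh)) => w.
ring.
Qed.

Lemma holder_coord_interp_le k (l : 'I_k -> nat) (alpha : 'I_k -> R) C X :
  (forall j, 0 < alpha j) -> 0 < C ->
  @holder_field R disp Omega P k l alpha C X ->
  coord_interp_le X (fun m r => Num.sqrt C * r `^ (starred alpha m / 2)).
Proof.
move=> a0 C0 [[XL _] hX] m t a b s ct a0' ab b1 s01.
have inc u v : 0 <= u <= 1 -> 0 <= v <= 1 -> `|u - v| <= b - a ->
    qm_le P (fun w => X (set_coord t m u) w - X (set_coord t m v) w)
      (Num.sqrt C * (b - a) `^ (starred alpha m / 2)).
  move=> u01 v01 uv.
  have cu := cube_set_coord m ct u01; have cv := cube_set_coord m ct v01.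
  have [A XA] := qm_le_Lfun (XL _ cu).
  have [B XB] := qm_le_Lfun (XL _ cv).
  apply: (qm_le_holder (ltW C0) (ltW (a0 _)) uv).
    by have [] := qm_leB XA XB.
  have := hX (set_coord t m v) ((u - v) *: delta_mx 0 m).
  by rewrite set_coordD subrKC starred_enorm// => /(_ cv cu).
have [s0 s1] := andP s01.
apply: qm_le_interp => //; apply: inc; rewrite ?ler_norml; nra.
Qed.

Lemma qm_partial_near d (X : 'rV[R]_d -> Omega -> R) i Y
    (t : 'rV[R]_d) (e : R) :
  is_qm_partial P X i Y -> cube t -> 0 < e -> exists2 r : R, 0 < r &
  forall u : R, cube (t + u *: delta_mx 0 i) -> u != 0 -> `|u| < r ->
    (qmnorm P (fun w => (X (t + u *: delta_mx 0 i) w - X t w) / u - Y t w)%R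
      <= e%:E)%E.
Proof.
move=> dX ct e0.
have /(dX _ ct) : nbhs (0%:E : \bar R) [set x | (x < e%:E)%E].
  exact: (@nbhs_open_ereal_lt _ _ (cst e)).
move=> /nbhs_ballP[r /= r0 Hr]; exists r => // u cu u0 ur; apply/ltW.
by apply: Hr => //=; rewrite /ball /= sub0r normrN.
Qed.

(** The field [g] is [X] on the segment minus an affine function of [u], so it
has the same interpolation error as [X]; its derivative [g'] vanishes at [a] and
is therefore bounded by the Hölder modulus [M] over the segment. *)
Lemma holder1_coord_interp_le k (l : 'I_k -> nat) (alpha : 'I_k -> R) C X :
  (forall j, 0 < alpha j) -> 0 < C ->
  @holder1_field R disp Omega P k l alpha C X ->
  coord_interp_le X (fun m r => Num.sqrt C * r `^ (1 + starred alpha m / 2)).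
Proof.
move=> a0 C0 [X' [[[XL _] dX] hX]] m t a b s ct a0' ab b1 s01.
have [dXm [XL' _]] := dX m.
pose Z u := set_coord t m u.
have cZ u : a <= u <= b -> cube (Z u).
  move=> /andP[au ub]; apply: cube_set_coord => //.
  by rewrite (le_trans a0')//= (le_trans ub).
pose M := Num.sqrt C * (b - a) `^ (starred alpha m / 2).
pose g u w := X (Z u) w - u * X' m (Z a) w.
pose g' u w := X' m (Z u) w - X' m (Z a) w.
have g'M c : a <= c <= b -> qm_le P (g' c) M.
  move=> cab; have [ac cb] := andP cab.
  have aab : a <= a <= b by rewrite lexx.
  have [A XA] := qm_le_Lfun (XL' _ (cZ _ cab)).
  have [B XB] := qm_le_Lfun (XL' _ (cZ _ aab)).
  have car : `|c - a| <= b - a by rewrite ger0_norm ?subr_ge0// lerD2r.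
  apply: (qm_le_holder (ltW C0) (ltW (a0 _)) car).
    by have [] := qm_leB XA XB.
  have := hX (Z a) ((c - a) *: delta_mx 0 m) (cZ _ aab).
  rewrite set_coordD subrKC.
  move=> /(_ (cZ _ cab) m); rewrite mxE [delta_mx _ _ _ _]mxE !eqxx mulr1.
  by rewrite set_coordD subrKC.
have gM x y : a <= x -> x <= y -> y <= b ->
    qm_le P (fun w => g y w - g x w) (M * (y - x)).
  move=> ax xy yb; apply: (qm_mean_value (g' := g')) => //.
    move=> c /andP[xc cy]; apply: g'M.
    by rewrite (le_trans ax)//= (le_trans cy).
  move=> c /andP[xc cy] e e0.
  have cab : a <= c <= b by rewrite (le_trans ax)//= (le_trans cy).
  have [r r0 Hr] := qm_partial_near dXm (cZ _ cab) e0.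
  exists r => // u /andP[xcu cuy] u0 ur.
  have cuab : a <= c + u <= b by rewrite (le_trans ax)//= (le_trans cuy).
  have := Hr u; rewrite set_coordD => /(_ (cZ _ cuab) u0 ur) H.
  have [A XA] := qm_le_Lfun (XL _ (cZ _ cuab)).
  have [B XB] := qm_le_Lfun (XL _ (cZ _ cab)).
  have [D XD] := qm_le_Lfun (XL' _ (cZ _ cab)).
  have [lf _] : qm_le P
      (fun w => (X (Z (c + u)) w - X (Z c) w) / u - X' m (Z c) w)
      (`|u^-1| * (A + B) + D).
    apply: qm_le_ext (qm_leB (qm_leZ u^-1 (qm_leB XA XB)) XD) => w.
    by rewrite mulrC.
  apply: qm_le_ext (conj lf H) => w.
  by rewrite /g /g'; field.
have [s0 s1] := andP s01.
have M0 : 0 <= M by rewrite mulr_ge0 ?sqrtr_ge0 ?powR_ge0.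
have -> : Num.sqrt C * (b - a) `^ (1 + starred alpha m / 2) = M * (b - a).
  rewrite powRD; last by rewrite gt_eqF// ltr_wpDr// divr_ge0// ltW// /starred.
  by rewrite powRr1 ?subr_ge0// mulrCA mulrC.
set u := a + s * (b - a).
have au : a <= u by rewrite /u; nra.
have ub : u <= b by rewrite /u; nra.
apply: (@qm_le_ext _ _ _ _ (fun w => g u w - ((1 - s) * g a w + s * g b w))).
  by move=> w; rewrite /g /Z /u; ring.
apply: qm_le_interp => //.
  apply: qm_le_weaken (gM _ _ _ au _) => //.
  by rewrite ler_wpM2l// lerD2r.
have /(qm_leZ (-1)) := gM _ _ au ub (lexx b); rewrite normrN1 mul1r => H.
apply: (@qm_le_weaken _ _ _ _ _ (M * (b - u))).
  by rewrite ler_wpM2l// lerD2l lerN2.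
by apply: qm_le_ext H => w; ring.
Qed.
End OneCoordinate.

(** * Interpolation over a cell *)

Section Weights.
Context {R : realType} {d : nat}.
Implicit Types (s : 'rV[R]_d) (e : {ffun 'I_d -> bool}).

Definition cell_weight s e : R :=
  \prod_m (s 0 m ^+ e m * (1 - s 0 m) ^+ (1 - e m)).

Lemma cell_weight_ge0 s e : cube s -> 0 <= cell_weight s e.
Proof.
move=> cs; apply: prodr_ge0 => m _; have /andP[s0 s1] := cs m.
by rewrite mulr_ge0// exprn_ge0// subr_ge0.
Qed.

Lemma sum_cell_weight s : \sum_e cell_weight s e = 1.
Proof.
rewrite -(bigA_distr_bigA
  (fun m (b : bool) => s 0 m ^+ b * (1 - s 0 m) ^+ (1 - b))).
rewrite big1// => m _; rewrite big_bool /=; ring.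
Qed.

Definition set_bit e (p : 'I_d) (b : bool) : {ffun 'I_d -> bool} :=
  [ffun m => if m == p then b else e m].

Lemma sum_set_bit (p : 'I_d) (F : {ffun 'I_d -> bool} -> R) :
  \sum_e F e = \sum_(e : {ffun 'I_d -> bool} | ~~ e p)
    (F (set_bit e p false) + F (set_bit e p true)).
Proof.
rewrite (bigID (fun e : {ffun 'I_d -> bool} => e p)) /= addrC big_split /=.
congr (_ + _).
  apply: eq_bigr => e /negbTE ep; congr F; apply/ffunP => m.
  by rewrite ffunE; case: eqP => // ->.
rewrite (reindex_onto (fun e => set_bit e p true)
  (fun e => set_bit e p false)) /=.
  apply: eq_bigl => e; rewrite ffunE eqxx /=.
  apply/eqP/idP => [<-|/negbTE ep]; first by rewrite ffunE eqxx.
  by apply/ffunP => m; rewrite !ffunE; case: eqP => // ->.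
move=> e ep; apply/ffunP => m; rewrite !ffunE.
by case: eqP => // ->.
Qed.

(** The vertex is chosen with independent coordinates, so its coordinate [p] may
be averaged out first, with the other coordinates held fixed. *)
Lemma cell_weight_resample s p (F : {ffun 'I_d -> bool} -> R) :
  \sum_e cell_weight s e * F e =
  \sum_e cell_weight s e *
    ((1 - s 0 p) * F (set_bit e p false) + s 0 p * F (set_bit e p true)).
Proof.
rewrite (sum_set_bit p) [RHS](sum_set_bit p); apply: eq_bigr => e _.
pose W := \prod_(m | m != p) (s 0 m ^+ e m * (1 - s 0 m) ^+ (1 - e m)).
have w b : cell_weight s (set_bit e p b) =
    s 0 p ^+ b * (1 - s 0 p) ^+ (1 - b) * W.
  rewrite /cell_weight (bigD1 p) //= ffunE eqxx; congr (_ * _).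
  by apply: eq_bigr => m /negbTE mp; rewrite ffunE mp.
have ff b b' : set_bit (set_bit e p b) p b' = set_bit e p b'.
  by apply/ffunP => m; rewrite !ffunE; case: eqP.
rewrite !w !ff /=; ring.
Qed.
End Weights.

Section CellInterpolant.
Context {R : realType} {disp : measure_display} {Omega : measurableType disp}.
Variable P : probability Omega R.

(** The error telescopes over the coordinates: [H p] averages [X] over the
points [Z p e], whose coordinates below [p] are those of the random vertex [e]
and whose other coordinates are those of the point itself.  Passing from
[H p] to [H p.+1] averages the one-coordinate errors along [p]. *)
Lemma cell_interpolant_error d (X : 'rV[R]_d -> Omega -> R)
    (E : 'I_d -> R -> R) (tau : 'I_d -> nat -> R) (i : {ffun 'I_d -> nat})
    (s : 'rV[R]_d) :
  coord_interp_le P X E -> cube s ->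
  (forall m, [/\ 0 <= tau m (i m), tau m (i m) <= tau m (i m).+1 &
                 tau m (i m).+1 <= 1]) ->
  qm_le P (fun w => X (grid_point tau i + hadamard (cell_size tau i) s) w -
      cell_interpolant X tau i s w)
    (\sum_m E m (tau m (i m).+1 - tau m (i m))).
Proof.
move=> EX cs htau.
pose lo m := tau m (i m); pose r m := tau m (i m).+1 - tau m (i m).
pose Z p (e : {ffun 'I_d -> bool}) : 'rV[R]_d :=
  \row_m (lo m + (if (m < p)%N then (e m)%:R else s 0 m) * r m).
pose H p w := \sum_e cell_weight s e * X (Z p e) w.
have r01 m c : 0 <= c <= 1 -> 0 <= lo m + c * r m <= 1.
  have [] := htau m; rewrite -/(lo m) /r -/(lo m); move: (tau m _) => hi.
  by move=> l0 lh h1 /andP[c0 c1]; apply/andP; split; nra.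
have cZ p e : cube (Z p e).
  move=> m; rewrite mxE; apply: r01; case: ifP => _; last exact: cs.
  by case: (e m); rewrite ?ler01 lexx.
pose t := grid_point tau i + hadamard (cell_size tau i) s.
have -> : (fun w => X t w - cell_interpolant X tau i s w) =
    (fun w => \sum_(m < d) (H m w - H m.+1 w)).
  apply/funext => w.
  have -> : \sum_(m < d) (H m w - H m.+1 w) = H 0 w - H d w.
    rewrite -[RHS]opprB -(telescope_sumr (fun m => H m w) (leq0n d)) big_mkord.
    by rewrite -sumrN; apply: eq_bigr => m _; rewrite opprB.
  congr (_ - _).
    rewrite /H; under eq_bigr => e _.
      rewrite (_ : Z 0%N e = t); last first.
        by apply/rowP => m; rewrite !mxE ffunE mulrC.
      over.
    by rewrite -mulr_suml sum_cell_weight mul1r.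
  apply: eq_bigr => e _; rewrite mulrC; congr (_ * X _ w).
  by apply/rowP => m; rewrite !mxE ffunE ltn_ord mulrC.
apply: qm_le_sum => p.
pose sc e b := set_coord (Z p e) p (lo p + b * r p).
have H1 w : H p.+1 w = \sum_e cell_weight s e *
    ((1 - s 0 p) * X (sc e 0) w + s 0 p * X (sc e 1) w).
  rewrite /H (cell_weight_resample s p).
  have Zb e (b : bool) : Z p.+1 (set_bit e p b) = sc e b%:R.
    apply/rowP => m; rewrite set_coordE !mxE ffunE ltnS leq_eqVlt val_eqE.
    by case: eqP => //= ->.
  by apply: eq_bigr => e _; rewrite !Zb.
apply: (@qm_le_ext _ _ _ _ (fun w => \sum_e cell_weight s e *
   (X (sc e (s 0 p)) w - ((1 - s 0 p) * X (sc e 0) w + s 0 p * X (sc e 1) w)))).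
  move=> w; rewrite H1 -sumrB; apply: eq_bigr => e _; rewrite mulrBr.
  congr (_ * X _ w - _); apply/rowP => m; rewrite set_coordE !mxE.
  by case: eqP => // ->; rewrite ltnn.
apply: qm_le_convex => [e||e]; [exact: cell_weight_ge0|exact: sum_cell_weight|].
have [l0 lh h1] := htau p.
have := EX p _ _ _ _ (cZ p e) l0 lh h1 (cs p).
by rewrite /sc mul0r addr0 mul1r subrKC.
Qed.
End CellInterpolant.

(** * Knots of a regular sequence *)

Section Densities.
Context {R : realType}.

Lemma density_min (f : R -> R) : positive_continuous_density f ->
  exists2 mu, 0 < mu & forall x, 0 <= x <= 1 -> mu <= f x.
Proof.
move=> [cf f0 _]; have [c c01 fc] := EVT_min (@ler01 R) cf.
exists (f c); first by apply: f0; rewrite in_itv in c01.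
by move=> x x01; apply: fc; rewrite in_itv.
Qed.

Lemma integral_growth (f : R -> R) mu a b : positive_continuous_density f ->
  0 < mu -> (forall x, 0 <= x <= 1 -> mu <= f x) ->
  0 <= a -> a <= b -> b <= 1 ->
  ((\int[lebesgue_measure]_(x in `[0%R, a]) (f x)%:E) + (mu * (b - a))%:E <=
    \int[lebesgue_measure]_(x in `[0%R, b]) (f x)%:E)%E.
Proof.
move=> [cf f0 _] mu0 muf a0 ab b1.
have mf01 : measurable_fun (`[0, 1] : set R) f.
  exact: subspace_continuous_measurable_fun.
have mf (A : set R) : A `<=` `[0, 1] -> measurable_fun A f.
  by move=> A01; apply: measurable_funS mf01.
have sb : (`[0, b] : set R) `<=` `[0, 1].
  by move=> x /=; rewrite !in_itv /= => /andP[-> /le_trans]; apply.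
have sab : (`]a, b] : set R) `<=` `[0, 1].
  move=> x /=; rewrite !in_itv /= => /andP[/ltW/(le_trans a0)-> /le_trans].
  by apply.
have eU : `[0, b]%classic = `[0, a]%classic `|` `]a, b]%classic :> set R.
  by rewrite -itv_bndbnd_setU// bnd_simp.
have f0' (x : R) : `[0, 1]%classic x -> (0 <= (f x)%:E)%E.
  by rewrite /= in_itv /= => x01; rewrite lee_fin ltW// f0.
rewrite eU ge0_integral_setU//=; first last.
- apply/disj_setPS => x [] /=; rewrite !in_itv /= => /andP[_ xa] /andP[ax _].
  by move: ax; rewrite ltNge xa.
- by move=> x xU; apply/f0'/sb; rewrite eU.
- by rewrite -eU; apply/measurable_EFinP; exact: mf.
apply: leeD => //.
have <- : (\int[lebesgue_measure]_(x in `]a, b]) (cst mu%:E x) =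
    (mu * (b - a))%:E)%E.
  rewrite integral_cst//= lebesgue_measure_itv /= lte_fin.
  by case: ltgtP ab => [_ _||-> _] //; rewrite subrr mulr0 mule0.
apply: ge0_le_integral => //=.
- by move=> x _; rewrite lee_fin ltW.
- by apply/measurable_EFinP; exact: mf.
- by move=> x /sab; rewrite /= in_itv /= lee_fin => /muf.
Qed.

End Densities.

Section Knots.
Context {R : realType}.
Variables (f : R -> R) (mu : R) (knot : nat -> R) (n : nat).
Hypotheses (hf : positive_continuous_density f) (mu0 : 0 < mu)
  (muf : forall x, 0 <= x <= 1 -> mu <= f x) (n0 : (0 < n)%N)
  (hknot : forall i, (i <= n)%N -> 0 <= knot i <= 1 /\
    (\int[lebesgue_measure]_(v in `[0%R, knot i]) (f v)%:E
       = (i%:R / n%:R)%:E)%E).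

Lemma knots_le_gap i j : (i <= n)%N -> (j <= n)%N -> knot i <= knot j ->
  mu * (knot j - knot i) <= (j%:R - i%:R) / n%:R.
Proof.
move=> /hknot[/andP[i0 i1] Ii] /hknot[/andP[j0 j1] Ij] ij.
have := integral_growth hf mu0 muf i0 ij j1.
by rewrite Ii Ij lee_fin mulrBl lerBrDl.
Qed.

(** The knots increase because the mass to their left does: were [knot i.+1] the
smaller one, the mass between the two would be negative. *)
Lemma knots_step i : (i < n)%N ->
  knot i <= knot i.+1 /\ knot i.+1 - knot i <= (mu * n%:R)^-1.
Proof.
move=> iltn; have ilen := ltnW iltn; have n0' : 0 < n%:R :> R by rewrite ltr0n.
have [le|lt] := leP (knot i) (knot i.+1).
  split=> //; have := knots_le_gap ilen iltn le.
  rewrite -natrB// subSnn invfM mul1r => H.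
  by rewrite -ler_pdivlMl// in H.
have := knots_le_gap iltn ilen (ltW lt).
rewrite -(opprB _ i%:R) -natrB// subSnn mulNr mul1r leNgt.
have -> // : - n%:R^-1 < mu * (knot i - knot i.+1).
by rewrite (@lt_trans _ _ 0)// ?oppr_lt0 ?invr_gt0// mulr_gt0// subr_gt0.
Qed.

Lemma knots_first : knot 0 = 0.
Proof.
have [/andP[t0 t1] It] := hknot (leq0n n).
have := integral_growth hf mu0 muf (lexx 0) t0 t1.
rewrite It set_itv1 integral_set1 add0e mul0r lee_fin subr0 pmulr_rle0// => t0'.
by apply/eqP; rewrite eq_le t0 t0'.
Qed.

Lemma knots_last : knot n = 1.
Proof.
have [/andP[t0 t1] It] := hknot (leqnn n); have [_ _ I1] := hf.
have := integral_growth hf mu0 muf t0 t1 (lexx 1).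
rewrite It I1 divff ?pnatr_eq0 -?lt0n// lee_fin gerDl pmulr_rle0// subr_le0.
move=> t1'.
by apply/eqP; rewrite eq_le t1 t1'.
Qed.

Lemma knots_cover x : 0 <= x <= 1 -> exists i : nat * R,
  [/\ (i.1 < n)%N, 0 <= i.2 <= 1 &
      x = knot i.1 + (knot i.1.+1 - knot i.1) * i.2].
Proof.
move=> /andP[x0 x1].
suff [i iltn /andP[ix xi]] : exists2 i, (i < n)%N & knot i <= x <= knot i.+1.
  have [le _] := knots_step iltn.
  have [e|ne] := eqVneq (knot i.+1) (knot i).
    exists (i, 0); rewrite /= lexx ler01 mulr0 addr0; split=> //.
    by apply/eqP; rewrite eq_le -{1}e xi.
  have lt : 0 < knot i.+1 - knot i by rewrite subr_gt0 lt_def ne.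
  exists (i, (x - knot i) / (knot i.+1 - knot i)); split=> //=.
    by rewrite divr_ge0 ?subr_ge0//= ler_pdivrMr// mul1r lerD2r.
  by rewrite mulrC divfK ?gt_eqF// subrKC.
suff cover p : (0 < p <= n)%N -> x <= knot p ->
    exists2 i, (i < n)%N & knot i <= x <= knot i.+1.
  by apply: (cover n); rewrite ?n0 ?leqnn ?knots_last.
elim: p => // p IH pn xp.
have [px|px] := leP (knot p) x; first by exists p; rewrite ?px.
case: p IH pn xp px => [|p] IH pn xp px; last exact: IH (ltnW pn) (ltW px).
by move: px; rewrite knots_first ltNge x0.
Qed.
End Knots.

(** * Rates of the multilinear interpolator *)

Lemma sum_starred (R : realType) k (l : 'I_k -> nat) (F : 'I_k -> R) :
  \sum_(m < \sum_(j < k) l j) starred F m = \sum_(j < k) (l j)%:R * F j.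
Proof.
transitivity (\sum_(j < k) \sum_(i < l j) F j); last first.
  by apply: eq_bigr => j _; rewrite sumr_const card_ord mulr_natl.
by rewrite sig_big_dep /= (reindex _ tagnat.sig_bij_on).
Qed.

Section Rates.
Context {R : realType} {disp : measure_display} {Omega : measurableType disp}.
Variable P : probability Omega R.

(** The cell that [mpli] selects contains the point, since the cells cover the
cube; the bound does not depend on which cell containing it is selected. *)
Lemma mpli_error d (X : 'rV[R]_d -> Omega -> R) (E : 'I_d -> R -> R)
    (f : 'I_d -> R -> R) (mu : 'I_d -> R) (ns : 'I_d -> nat)
    (tau : 'I_d -> nat -> R) :
  coord_interp_le P X E ->
  (forall m, {in Num.nneg &, {homo E m : x y / x <= y}}) ->
  (forall m, positive_continuous_density (f m)) -> (forall m, 0 < mu m) ->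
  (forall m x, 0 <= x <= 1 -> mu m <= f m x) -> (forall m, (0 < ns m)%N) ->
  (forall m i, (i <= ns m)%N -> 0 <= tau m i <= 1 /\
    (\int[lebesgue_measure]_(v in `[0%R, tau m i]) (f m v)%:E =
       (i%:R / (ns m)%:R)%:E)%E) ->
  (qmsupnorm P (fun t => X t \- mpli X ns tau t)%R <=
     (\sum_m E m (mu m * (ns m)%:R)^-1)%:E)%E.
Proof.
move=> EX Emono hf mu0 muf ns0 htau.
apply: ge_ereal_sup => _ [t ct <-].
have ex : exists p, cell_coordinates ns tau t p.
  have /choice[i hi] m :=
    knots_cover (hf m) (mu0 m) (muf m) (ns0 m) (htau m) (ct m).
  exists ([ffun m => (i m).1], \row_m (i m).2); split=> /=.
  - by move=> m; rewrite ffunE; have [] := hi m.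
  - by move=> m; rewrite mxE; have [] := hi m.
  - by apply/rowP => m; rewrite !mxE !ffunE; have [] := hi m.
rewrite /mpli; have := xgetPex ([ffun=> 0%N], 0) ex.
move: (xget _ _) => [i s] /= [ins cs ->].
have step m := knots_step (hf m) (mu0 m) (muf m) (ns0 m) (htau m) (ins m).
have [|_] := cell_interpolant_error (tau := tau) (i := i) EX cs.
  move=> m; have [? _] := step m.
  have [/andP[? _] _] := htau m _ (ltnW (ins m)).
  by have [/andP[_ ?] _] := htau m _ (ins m).
move=> /le_trans; apply; rewrite lee_fin; apply: ler_sum => m _.
have [le gap] := step m; apply: Emono => //; rewrite nnegrE ?subr_ge0//.
by rewrite invr_ge0 mulr_ge0// ltW.
Qed.

(** A coordinate of block [j] contributes at most [A * (mu_j * n_j)^(-beta_j)],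
where [mu_j] is a positive lower bound of [h j], and the block has [l j]
coordinates. *)
Lemma mpli_rate k (l : 'I_k -> nat) (beta : 'I_k -> R) (h : 'I_k -> R -> R)
    (A : R) (X : 'rV[R]_(\sum_(j < k) l j) -> Omega -> R) :
  (forall j, (0 < l j)%N) -> (forall j, 0 <= beta j) -> 0 <= A ->
  (forall j, positive_continuous_density (h j)) ->
  coord_interp_le P X (fun m r => A * r `^ starred beta m) ->
  exists c : 'I_k -> R, (forall j, 0 < c j) /\
    forall (n : 'I_k -> nat) (tau : 'I_(\sum_(j < k) l j) -> nat -> R),
      (forall j, (0 < n j)%N) -> is_cRS h n tau ->
      (qmsupnorm P (fun t => X t \- mpli X (starred n) tau t)%R <=
         (A * \sum_(j < k) c j / (n j)%:R `^ beta j)%:E)%E.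
Proof.
move=> l0 beta0 A0 hh EX.
have /choice[mu hmu] j :
    exists mu, 0 < mu /\ forall x, 0 <= x <= 1 -> mu <= h j x.
  by have [mu mu0 muh] := density_min (hh j); exists mu.
exists (fun j => (l j)%:R * (mu j)^-1 `^ beta j); split=> [j|n tau n0 htau].
  by rewrite mulr_gt0 ?ltr0n// powR_gt0// invr_gt0; have [] := hmu j.
have mono (m : 'I_(\sum_(j < k) l j)) : {in Num.nneg &,
    {homo (fun r : R => A * r `^ starred beta m) : x y / x <= y}}.
  by move=> x y x0 y0 xy; rewrite ler_wpM2l// ge0_ler_powR// /starred.
have := mpli_error EX mono (fun m => hh (tagnat.sig1 m))
  (fun m => (hmu (tagnat.sig1 m)).1) (fun m => (hmu (tagnat.sig1 m)).2)
  (fun m => n0 (tagnat.sig1 m)) htau.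
move=> /le_trans; apply; rewrite lee_fin -mulr_sumr ler_wpM2l//.
rewrite (sum_starred l (fun j => (mu j * (n j)%:R)^-1 `^ beta j)).
apply: ler_sum => j _; rewrite -mulrA ler_wpM2l//.
have [mu0 _] := hmu j.
rewrite invfM powRM ?invr_ge0 ?(ltW mu0)//.
by rewrite -[in X in _ * X](powR_inv1 (ler0n _ _)) -powRrM mulN1r powRN.
Qed.
End Rates.

Theorem proposition3 (R : realType) (disp : measure_display)
  (Omega : measurableType disp) (P : probability Omega R)
  (k : nat) (l : 'I_k -> nat) (hl : forall j, (0 < l j)%N)
  (alpha : 'I_k -> R) (halpha : forall j, 0 < alpha j < 2)
  (C : R) (hC : 0 < C)
  (h : 'I_k -> R -> R) (hh : forall j, positive_continuous_density (h j))
  (Ns : set nat) (hNs : infinite_set Ns) (hNs0 : forall N, Ns N -> (0 < N)%N)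
  (n : nat -> 'I_k -> nat) (hn0 : forall N, Ns N -> forall j, (0 < n N j)%N)
  (hnN : forall N, Ns N -> (\prod_(j < k) (n N j).+1 ^ l j)%N = N)
  (hnoo : forall j, n N j @[N --> within Ns \oo] --> \oo)
  (tau : nat -> 'I_(\sum_(j < k) l j) -> nat -> R)
  (htau : forall N, Ns N -> is_cRS h (n N) (tau N))
  (X : 'rV[R]_(\sum_(j < k) l j) -> Omega -> R) (hX : qm_continuous P X) :
  (holder_field P alpha C X ->
     exists c : 'I_k -> R, (forall j, 0 < c j) /\
       forall N, Ns N ->
         (qmsupnorm P (fun t => X t \- mpli X (starred (n N)) (tau N) t)%R
            <= (Num.sqrt C *
                \sum_(j < k) c j / (n N j)%:R `^ (alpha j / 2))%:E)%E) /\
  (holder1_field P alpha C X ->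
     exists d : 'I_k -> R, (forall j, 0 < d j) /\
       forall N, Ns N ->
         (qmsupnorm P (fun t => X t \- mpli X (starred (n N)) (tau N) t)%R
            <= (Num.sqrt C *
                \sum_(j < k) d j / (n N j)%:R `^ (1 + alpha j / 2))%:E)%E).
Proof.
have a0 j : 0 < alpha j by have /andP[] := halpha j.
have ah j : 0 <= alpha j / 2 by rewrite divr_ge0// ltW.
have rate (beta : 'I_k -> R) : (forall j, 0 <= beta j) ->
    coord_interp_le P X (fun m r => Num.sqrt C * r `^ starred beta m) ->
    exists c : 'I_k -> R, (forall j, 0 < c j) /\
      forall N, Ns N ->
        (qmsupnorm P (fun t => X t \- mpli X (starred (n N)) (tau N) t)%R
           <= (Num.sqrt C * \sum_(j < k) c j / (n N j)%:R `^ beta j)%:E)%E.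
  move=> beta0 EX.
  have [c [c0 cP]] := mpli_rate hl beta0 (sqrtr_ge0 C) hh EX.
  by exists c; split=> // N NN; apply: cP; [exact: hn0|exact: htau].
split=> HX; apply: rate.
- exact: ah.
- exact: holder_coord_interp_le a0 hC HX.
- by move=> j; rewrite addr_ge0.
- exact: holder1_coord_interp_le a0 hC HX.
Qed.
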